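(* One has $\mathring\mu_5(3|2)_1\le 6$.
   Context: A subspace of $\mathbb{R}^n$ is rational if it has a basis of vectors with rational coordinates; $\mathfrak{R}_n(e)$ denotes the set of rational subspaces of $\mathbb{R}^n$ of dimension $e$. A subspace $A$ of $\mathbb{R}^n$ is $(e,j)$-irrational if $\dim(A\cap B)<j$ for all $B\in\mathfrak{R}_n(e)$; $\mathfrak{I}_n(d,e)_j$ denotes the set of all $(e,j)$-irrational subspaces of dimension $d$ of $\mathbb{R}^n$. Height: for $B\in\mathfrak{R}_n(e)$, let $\Xi\in\mathbb{Z}^N$, $N=\binom ne$, be a vector of Pl\''ucker coordinates of $B$ which is integral with setwise coprime coordinates; $H(B)=\Vert\Xi\Vert$ (Euclidean norm). Equivalently $H(B)$ is the covolume of $B\cap\mathbb{Z}^n$ in $B$. Proximity: $\mathbb{R}^n$ has its standard Euclidean structure. For nonzero $X,Y\in\mathbb{R}^n$, $\psi(X,Y)=\Vert X\wedge Y\Vert/(\Vert X\Vert\,\Vert Y\Vert)$ is the sine of the angle between $X$ and $Y$. For subspaces $A,B$ of $\mathbb{R}^n$ of dimensions $d,e\ge 1$ and $t=\min(d,e)$, define inductively $\psi_1(A,B)=\min\{\psi(X,Y): X\in A\setminus\{0\},Y\in B\setminus\{0\}\}$, attained at unit vectors $X_1\in A$, $Y_1\in B$; and, given $(X_1,Y_1),\dots,(X_j,Y_j)$ with $j<t$, let $A_j$ (resp. $B_j$) be the orthogonal complement of $\mathrm{Span}(X_1,\dots,X_j)$ in $A$ (resp. of $\mathrm{Span}(Y_1,\dots,Y_j)$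 in $B$), and $\psi_{j+1}(A,B)=\min\{\psi(X,Y): X\in A_j\setminus\{0\},Y\in B_j\setminus\{0\}\}$, attained at unit vectors $X_{j+1},Y_{j+1}$. (These are the sines of the canonical angles between $A$ and $B$ and do not depend on the choices.) Exponents: let $n\ge 2$, $d,e\in\{1,\dots,n-1\}$ with $d+e\le n$, $j\in\{1,\dots,\min(d,e)\}$. For $A\in\mathfrak{I}_n(d,e)_j$, $\mu_n(A|e)_j\in[0,+\infty]$ is the supremum of all $\beta>0$ such that $\psi_j(A,B)\le H(B)^{-\beta}$ holds for infinitely many $B\in\mathfrak{R}_n(e)$. Set $\mathring\mu_n(d|e)_j=\inf_{A\in\mathfrak{I}_n(d,e)_j}\mu_n(A|e)_j$. *)

(* Defs.v *)
From mathcomp Require Import all_boot all_order all_algebra.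
From mathcomp Require Import all_classical all_reals all_analysis.

Set Implicit Arguments.
Unset Strict Implicit.
Unset Printing Implicit Defensive.

Import Order.TTheory GRing.Theory Num.Theory.

Local Open Scope classical_set_scope.
Local Open Scope ring_scope.

Section Subspaces.
Variables (R : realType) (n : nat).
Implicit Types (X Y : 'rV[R]_n) (A B U V : {vspace 'rV[R]_n}).

Definition is_rational B : Prop :=
  exists X : (\dim B).-tuple 'rV[rat]_n,
    basis_of B (map (map_mx (ratr : rat -> R)) X).

Definition rational_subspaces (e : nat) : set {vspace 'rV[R]_n} :=
  [set B | is_rational B /\ \dim B = e].

Definition irrational_subspaces (d e j : nat) : set {vspace 'rV[R]_n} :=
  [set A | \dim A = d /\
    forall B, rational_subspaces e B -> (\dim (A :&: B) < j)%N].

(* The library norm on 'rV[R]_n is the sup norm, hence these explicit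
   Euclidean norms. *)
Definition enorm X : R := Num.sqrt (\sum_(i < n) X 0 i ^+ 2).

Definition wedge_norm X Y : R :=
  Num.sqrt (\sum_(i < n) \sum_(j < n | (i < j)%N)
    (X 0 i * Y 0 j - X 0 j * Y 0 i) ^+ 2).

Definition sin_angle X Y : R := wedge_norm X Y / (enorm X * enorm Y).

(* The infimum is a minimum as soon as U and V are nonzero, by compactness of
   the unit spheres. *)
Definition min_sin_angle U V : R :=
  inf [set r | exists X Y,
    [/\ X \in U, X != 0, Y \in V, Y != 0 & r = sin_angle X Y]].

Definition is_minimizing_pair U V (p : 'rV[R]_n * 'rV[R]_n) : Prop :=
  [/\ p.1 \in U, enorm p.1 = 1, p.2 \in V, enorm p.2 = 1
    & sin_angle p.1 p.2 = min_sin_angle U V].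

Definition minimizing_pair U V : 'rV[R]_n * 'rV[R]_n :=
  xget (0, 0) [set p | is_minimizing_pair U V p].

Definition orthogonal_hyperplane X : {vspace 'rV[R]_n} :=
  lker (linfun (mulmxr X^T : 'rV[R]_n -> 'rV[R]_1)).

(* The pair (A_k, B_k), with (A_0, B_0) = (A, B): A_k is the orthogonal
   complement of Span(X_1, .., X_k) in A, i.e. of X_k in A_(k-1), where
   (X_k, Y_k) is a minimizing pair for (A_(k-1), B_(k-1)); likewise for B_k. *)
Fixpoint canonical_complements A B (k : nat) :
    {vspace 'rV[R]_n} * {vspace 'rV[R]_n} :=
  if k is k'.+1 then
    let: (U, V) := canonical_complements A B k' in
    let: (X, Y) := minimizing_pair U V in
    ((U :&: orthogonal_hyperplane X)%VS, (V :&: orthogonal_hyperplane Y)%VS)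
  else (A, B).

(* Meaningful for 1 <= j <= min(dim A, dim B). *)
Definition proximity (j : nat) A B : R :=
  let: (U, V) := canonical_complements A B j.-1 in min_sin_angle U V.

(* The e-element subsets of {0, .., n-1}, as strictly increasing maps. *)
Definition increasing_map (e : nat) (s : {ffun 'I_e -> 'I_n}) : bool :=
  [forall i : 'I_e, forall k : 'I_e, (i < k)%N ==> (s i < s k)%N].

(* Plucker coordinates are homogeneous, hence the factor c. *)
Definition is_plucker_vector (e : nat) B (Xi : {ffun 'I_e -> 'I_n} -> R) :
    Prop :=
  exists (X : e.-tuple 'rV[R]_n) (c : R),
    [/\ basis_of B X, c != 0
      & forall s, increasing_map s ->
          Xi s = c * \det (colsub s (\matrix_(i < e) tnth X i))].

Definition is_primitive_plucker_vector B
    (Xi : {ffun 'I_(\dim B) -> 'I_n} -> int) : Prop :=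
  is_plucker_vector B (fun s => (Xi s)%:~R) /\
  \big[gcdn/0%N]_(s | increasing_map s) `|Xi s|%N = 1%N.

(* A rational subspace has exactly two primitive integral Plucker vectors,
   which are opposite, so the value chosen by xget is the only candidate. *)
Definition height B : R :=
  xget 0 [set h | exists2 Xi, is_primitive_plucker_vector Xi
    & h = Num.sqrt (\sum_(s : {ffun 'I_(\dim B) -> 'I_n} | increasing_map s)
                      (Xi s)%:~R ^+ 2)].

(* The maximum with 0 gives the supremum of the empty set the value 0. *)
Definition exponent A (e j : nat) : \bar R :=
  maxe 0%E (ereal_sup [set beta%:E | beta in
    [set beta : R | 0 < beta /\
      infinite_set [set B | rational_subspaces e B /\
        proximity j A B <= height B `^ (- beta)]]]).

End Subspaces.

Definition least_exponent (R : realType) (n d e j : nat) : \bar R :=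
  ereal_inf [set exponent A e j | A in @irrational_subspaces R n d e j].

(* Main.v *)
(* Let t be a real root of X^5 - X^2 - 1, and let A be the 3-dimensional space
   of common zeros of the linear forms a = sum_i t^i x_i and
   b = sum_i t^(2i) x_i.  If P is the integral antisymmetric matrix of primitive
   Plucker coordinates of a rational plane B, then
   L = sum_(k, l) P_(k, l) t^(k + 2l) satisfies |L| <= C H(B) psi_1(A, B), so
   that it suffices to bound L from below.  Let M be the integral matrix of
   multiplication by sum_(k, l) P_(k, l) X^(k + 2l) in Z[X]/(X^5 - X^2 - 1);
   the row (1, t, .., t^4) is a left eigenvector of M with eigenvalue L, whence
   |det M| <= C' |L| H(B)^4.  Finally det M is odd: modulo 2 the matrix P is
   u /\ v for two distinct nonzero rows u and v of P, squaring is additive, and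
   the element above becomes u v^2 - v u^2 = u v (v - u), which is nonzero
   since X^5 - X^2 - 1 is irreducible over F_2.  Hence psi_1(A, B) >= c H(B)^-5,
   and B is determined by P, so that only finitely many B have bounded
   height. *)

Require Import Defs.
From mathcomp Require Import all_boot all_order all_algebra.
From mathcomp Require Import all_classical all_reals all_analysis.
From mathcomp Require Import perm ring lra zify.

Set Implicit Arguments.
Unset Strict Implicit.
Unset Printing Implicit Defensive.

Import Order.TTheory GRing.Theory Num.Theory.

Local Open Scope ring_scope.

(** * Multiplication matrices modulo X^5 - X^2 - 1 *)

(* The columns of this matrix are the coordinates of X, X^2, X^3, X^4 and
   X^5 = X^2 + 1 in the basis 1, X, .., X^4. *)
Definition quintic_mx (T : pzSemiRingType) : 'M[T]_5 :=
  \matrix_(i, j) ((i == j.+1 :> nat)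
    || (j == 4 :> nat) && ((i == 0 :> nat) || (i == 2 :> nat)))%:R.

(** The matrix [M] of the overview. The exponents [k + l.*2] pair the coefficients t^k of the form a
    with the coefficients t^(2l) of the form b. *)
Definition plucker_mx (T : nzRingType) (P : 'M[T]_5) : 'M[T]_5 :=
  \sum_k \sum_l P k l *: quintic_mx T ^+ (k + l.*2).

Lemma map_quintic_mx (T T' : nzRingType) (f : {rmorphism T -> T'}) :
  map_mx f (quintic_mx T) = quintic_mx T'.
Proof. by apply/matrixP => i j; rewrite !mxE rmorph_nat. Qed.

Lemma map_plucker_mx (T T' : nzRingType) (f : {rmorphism T -> T'})
    (P : 'M[T]_5) :
  map_mx f (plucker_mx P) = plucker_mx (map_mx f P).
Proof.
rewrite /plucker_mx raddf_sum; apply: eq_bigr => k _.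
rewrite raddf_sum; apply: eq_bigr => l _.
by rewrite /= map_mxZ mxE rmorphXn /= map_quintic_mx.
Qed.

Lemma forall_ord5 (Q : 'I_5 -> Prop) :
  Q (@Ordinal 5 0 isT) -> Q (@Ordinal 5 1 isT) -> Q (@Ordinal 5 2 isT) ->
  Q (@Ordinal 5 3 isT) -> Q (@Ordinal 5 4 isT) -> forall i, Q i.
Proof.
move=> Q0 Q1 Q2 Q3 Q4 [i lti].
by case: i lti => [|[|[|[|[|//]]]]] lti; rewrite (bool_irrelevance lti isT).
Qed.

(** All columns of the companion matrix are unit vectors, except the last, which is e_0 + e_2; right
    multiplication is thus a shift of columns. *)
Lemma mulmx_quintic (T : pzSemiRingType) m (A : 'M[T]_(m, 5)) i :
  let B := A *m quintic_mx T in
  (B i (@Ordinal 5 0 isT) = A i (@Ordinal 5 1 isT)) *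
  (B i (@Ordinal 5 1 isT) = A i (@Ordinal 5 2 isT)) *
  (B i (@Ordinal 5 2 isT) = A i (@Ordinal 5 3 isT)) *
  (B i (@Ordinal 5 3 isT) = A i (@Ordinal 5 4 isT)) *
  (B i (@Ordinal 5 4 isT) = A i (@Ordinal 5 0 isT) + A i (@Ordinal 5 2 isT)).
Proof.
split; [split; [split; [split|]|]|]; rewrite mxE !big_ord_recl big_ord0 !mxE /=;
  rewrite ?(mulr0, mulr1, addr0, add0r).
all: try congr (_ + _); congr (A i _); exact: val_inj.
Qed.

Lemma quintic_mx_expr5 (T : nzRingType) :
  quintic_mx T ^+ 5 = quintic_mx T ^+ 2 + 1.
Proof.
(* Writing the powers as successive products from the right turns each entry into a chain of column
   shifts. *)
have -> : quintic_mx T ^+ 2 = 1 *m quintic_mx T *m quintic_mx T.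
  by rewrite mul1mx mulmxE -expr2.
have -> : quintic_mx T ^+ 5 = 1 *m quintic_mx T *m quintic_mx T *m quintic_mx T
    *m quintic_mx T *m quintic_mx T.
  by rewrite mul1mx !mulmxE -!expr2 -!exprSr.
apply/matrixP => i; apply: forall_ord5; rewrite [RHS]mxE !mulmx_quintic !mxE;
 move: i; apply: forall_ord5; rewrite /= ?(addr0, add0r) //.
Qed.

Lemma mulmx_quintic_powers (T : comNzRingType) (t : T) :
  t ^+ 5 = t ^+ 2 + 1 ->
  (\row_(i < 5) t ^+ i) *m quintic_mx T = t *: \row_(i < 5) t ^+ i.
Proof.
move=> t5; apply/matrixP => i; apply: forall_ord5;
  rewrite !mulmx_quintic !mxE -?exprS //.
by rewrite /= t5 addrC.
Qed.

Lemma mulmx_plucker_powers (T : comNzRingType) (t : T) (P : 'M[T]_5) :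
  t ^+ 5 = t ^+ 2 + 1 ->
  (\row_(i < 5) t ^+ i) *m plucker_mx P
    = (\sum_k \sum_l P k l * (t ^+ k * t ^+ l.*2)) *: \row_(i < 5) t ^+ i.
Proof.
move=> t5.
have powE n : (\row_(i < 5) t ^+ i) *m quintic_mx T ^+ n
    = t ^+ n *: \row_(i < 5) t ^+ i.
  elim: n => [|n IHn]; first by rewrite !expr0 mulmx1 scale1r.
  rewrite exprSr -mulmxE mulmxA IHn -scalemxAl mulmx_quintic_powers // scalerA.
  by rewrite -exprSr.
rewrite /plucker_mx mulmx_sumr scaler_suml; apply: eq_bigr => k _.
rewrite mulmx_sumr scaler_suml; apply: eq_bigr => l _.
by rewrite -scalemxAr powE scalerA exprD.
Qed.

(* Multiplication by X in F_2[X]/(X^5 + X^2 + 1), on coefficient vectors. *)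
Definition quintic_shift (b : bool * bool * bool * bool * bool) :=
  let: (b0, b1, b2, b3, b4) := b in (b4, b0, b1 (+) b4, b2, b3).

(* X^5 + X^2 + 1 is primitive: X generates the multiplicative group of F_32. *)
Lemma quintic_shift_transitive b :
  b != (false, false, false, false, false) ->
  exists k, b = iter k quintic_shift (true, false, false, false, false).
Proof.
move=> b0; suff /trajectP[k _ ->] :
    b \in traject quintic_shift (true, false, false, false, false) 31.
  by exists k.
by move: b b0 => [[[[[] []] []] []] []].
Qed.

Lemma F2_bool (x : 'F_2) : x = (x != 0)%:R.
Proof. by move: x => [[|[|//]] ?]; apply/val_inj. Qed.

(** Multiplication by [c] acts on the coefficients by [quintic_shift], so the transitivity of the
    shift carries over to any ring of characteristic 2 with a root [c]. *)
Lemma quintic_combination_power (A : nzRingType) (c : A) b :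
  1 + 1 = 0 :> A -> c ^+ 5 = c ^+ 2 + 1 ->
  b != (false, false, false, false, false) ->
  let: (b0, b1, b2, b3, b4) := b in
  exists k, 1 *+ b0 + c *+ b1 + c ^+ 2 *+ b2 + c ^+ 3 *+ b3 + c ^+ 4 *+ b4
            = c ^+ k.
Proof.
move=> A2 c5 /quintic_shift_transitive[k ->] {b}.
pose val (b : bool * bool * bool * bool * bool) : A :=
  let: (b0, b1, b2, b3, b4) := b in
  1 *+ b0 + c *+ b1 + c ^+ 2 *+ b2 + c ^+ 3 *+ b3 + c ^+ 4 *+ b4.
have addxx (x : A) : x + x = 0 by rewrite -[x]mulr1 -mulrDr A2 mulr0.
have val_shift b : val (quintic_shift b) = c * val b.
  move: b => [[[[b0 b1] b2] b3] b4]; rewrite /val /=.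
  have -> : c ^+ 2 *+ (b1 (+) b4) = c ^+ 2 *+ b1 + c ^+ 2 *+ b4.
    by case: b1; case: b4; rewrite /= ?(addr0, add0r, addxx).
  rewrite !mulrDr !mulrnAr mulr1 -!exprS -expr2 c5 mulrnDl.
  by rewrite [LHS](AC (2*2*1*1) ((2*3*5*6)*(4*1))).
have valP : val (iter k quintic_shift (true, false, false, false, false)) = c ^+ k.
  elim: k => [|k IHk]; first by rewrite /val /= !addr0.
  by rewrite iterS val_shift IHk exprS.
by move: (iter _ _ _) valP => [[[[b0 b1] b2] b3] b4] /= valP; exists k.
Qed.

(** This takes the place of irreducibility: the value of [p] is invertible because it is a power of
    the invertible companion matrix. *)
Lemma horner_quintic_mx_power (p : {poly 'F_2}) :
  p != 0 -> (size p <= 5)%N ->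
  exists k, horner_mx (quintic_mx 'F_2) p = quintic_mx 'F_2 ^+ k.
Proof.
move=> p0 sp; pose b i : bool := p`_i != 0.
have pE : p = 'X^0 *+ b 0 + 'X *+ b 1 + 'X^2 *+ b 2 + 'X^3 *+ b 3 + 'X^4 *+ b 4.
  rewrite -[p in LHS](coefK p) poly_def (big_ord_widen 5 (fun i => p`_i *: 'X^i)) //.
  rewrite big_mkcond /=.
  have E (i : nat) : (if (i < size p)%N then p`_i *: 'X^i else 0) = 'X^i *+ b i.
    rewrite /b; case: ltnP => [_|/leq_sizeP->//].
    by rewrite [p`_i in LHS]F2_bool scaler_nat.
  under eq_bigr do rewrite E.
  by rewrite !big_ord_recl big_ord0 !addrA addr0.
have b0 : (b 0, b 1, b 2, b 3, b 4)%N != (false, false, false, false, false).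
  apply: contra_neq p0; case=> b0 b1 b2 b3 b4.
  by rewrite pE b0 b1 b2 b3 b4 !mulr0n !addr0.
have c2 : 1 + 1 = 0 :> 'M['F_2]_5.
  rewrite -[1 + 1]/(2%:R) -scaler_nat.
  by rewrite (_ : 2%:R = 0) ?scale0r//; apply/val_inj.
have [k kE] := quintic_combination_power c2 (quintic_mx_expr5 _) b0.
exists k; rewrite -kE [in LHS]pE.
by rewrite !rmorphD /= !rmorphMn /= !rmorphXn /= !horner_mx_X expr0.
Qed.

(** If P i j = 1, the relations make [P] the wedge of its rows u = row i and v = row j. The matrix
    is then the value of u v (v - u), whose three factors are nonzero of degree at most 4, hence
    powers of X modulo the quintic. *)
Lemma det_plucker_mx_F2 (P : 'M['F_2]_5) :
  (forall i, P i i = 0) -> (forall i j, P i j = - P j i) ->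
  (forall i j k l, P i j * P k l = P i k * P j l - P i l * P j k) ->
  P != 0 -> \det (plucker_mx P) != 0.
Proof.
move=> Pii Pa Pp /matrix0Pn[i [j Pij0]].
have Pij : P i j = 1 by rewrite [LHS]F2_bool Pij0.
pose row k : {poly 'F_2} := \sum_(l < 5) P k l *: 'X^l.
have rowE k (l : 'I_5) : (row k)`_l = P k l.
  rewrite /row coef_sum (bigD1 l) //= coefZ coefXn eqxx mulr1 big1 ?addr0 // => m ml.
  by rewrite coefZ coefXn eq_sym (negPf (ml : (m != l :> nat))) mulr0.
have size_row k : (size (row k) <= 5)%N.
  apply: (leq_trans (size_sum _ _ _)); apply/bigmax_leqP => l _.
  by rewrite (leq_trans (size_scale_leq _ _)) // size_polyXn ltn_ord.
(* Frobenius fixes the coefficients in F_2 and doubles the exponents; this explains the choice of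
   t^(2l) in the second form. *)
have sqr_row k : row k ^+ 2 = \sum_(l < 5) P k l *: 'X^(l.*2).
  have ch2 : 2%N \in [pchar {poly 'F_2}] by rewrite pchar_poly pchar_Fp.
  rewrite -(pFrobenius_autE ch2) rmorph_sum; apply: eq_bigr => l _.
  rewrite [LHS]pFrobenius_autE exprZn -exprM muln2; congr (_ *: _).
  by rewrite [P k l]F2_bool; case: (_ != 0); rewrite ?expr1n ?expr0n.
have row_neq0 k l : P k l != 0 -> row k != 0.
  by apply: contraNneq => r0; rewrite -rowE r0 coef0.
have Pji : P j i = 1.
  by rewrite Pa Pij; apply/val_inj.
have rijN0 : row j - row i != 0.
  apply/eqP => /(congr1 (fun p : {poly 'F_2} => p`_i)).
  by rewrite coefB coef0 !rowE Pii subr0 Pji => /eqP; rewrite oner_eq0.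
have -> : plucker_mx P = horner_mx (quintic_mx 'F_2)
    (row i * row j * (row j - row i)).
  have -> : row i * row j * (row j - row i) =
     \sum_(k < 5) \sum_(l < 5) P k l *: 'X^(k + l.*2).
    have -> : row i * row j * (row j - row i)
      = row i * row j ^+ 2 - row j * row i ^+ 2 by ring.
    rewrite !sqr_row /row !mulr_suml -sumrB; apply: eq_bigr => k _.
    rewrite !mulr_sumr -sumrB; apply: eq_bigr => l _.
    rewrite -!scalerAl -!scalerAr !scalerA -exprD -scalerBl.
    by rewrite -[P k l]mul1r -Pij Pp [P i l * _]mulrC.
  rewrite /plucker_mx rmorph_sum; apply: eq_bigr => k _.
  rewrite rmorph_sum; apply: eq_bigr => l _.
  by rewrite /= horner_mxZ rmorphXn /= horner_mx_X.
have [|a aE] := horner_quintic_mx_power _ (size_row i).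
  by apply: (row_neq0 i j).
have [|b bE] := horner_quintic_mx_power _ (size_row j).
  by apply: (row_neq0 j i); rewrite Pji.
have [|c cE] := horner_quintic_mx_power rijN0.
  by rewrite (leq_trans (size_polyD _ _)) // size_polyN geq_max !size_row.
(* The equation c^5 = c^2 + 1 reads c (c^4 - c) = 1, which exhibits the inverse of the companion
   matrix. *)
have [uC _] : quintic_mx 'F_2 \in unitmx /\
    quintic_mx 'F_2 ^+ 4 - quintic_mx 'F_2 \in unitmx.
  apply: mulmx1_unit.
  by rewrite mulmxE mulrBr -exprS -expr2 quintic_mx_expr5 addrC addKr.
rewrite !rmorphM /= aE bE cE -!exprD -unitfE.
elim: (_ + _)%N => [|n IHn].
  by rewrite expr0 det1 unitr1.
by rewrite exprS -mulmxE det_mulmx unitrM -unitmxE uC.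
Qed.

(** Were the determinant zero, so would be its reduction modulo 2, and the case of F_2 would force
    all entries of [P] to be even. *)
Lemma odd_det_plucker_mx (P : 'M[int]_5) :
  (forall i, P i i = 0) -> (forall i j, P i j = - P j i) ->
  (forall i j k l, P i j * P k l = P i k * P j l - P i l * P j k) ->
  (exists i j, odd `|P i j|%N) -> \det (plucker_mx P) != 0.
Proof.
move=> Pii Pa Pp [i [j oddP]].
apply: contraTneq oddP => det0.
pose f : {rmorphism int -> 'F_2} := intmul 1.
have natE n : (n%:R == 0 :> 'F_2) = ~~ odd n.
  by rewrite -(dvdn_pcharf (pchar_Fp (isT : prime 2))) dvdn2.
have fE x : (f x == 0) = ~~ odd `|x|%N.
  rewrite /f /=; case: x => n; last rewrite NegzE mulrNz oppr_eq0 abszN.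
    exact: natE.
  exact: natE.
rewrite -fE.
have : map_mx f P == 0.
  apply: contraT => P0.
  have := @det_plucker_mx_F2 (map_mx f P) _ _ _ P0.
  rewrite -map_plucker_mx det_map_mx det0 rmorph0 eqxx.
  by apply=> *; rewrite !mxE -?rmorphM -?rmorphB -?rmorphN -?Pp -?Pa ?Pii ?rmorph0.
by move/eqP/matrixP/(_ i j); rewrite !mxE => ->.
Qed.

(** The bound is taken row by row because, in the application, the row of powers of t stays bounded
    while the other four rows grow with the height. *)
Lemma norm_det_le (R : numDomainType) n (M : 'M[R]_n) (c : 'I_n -> R) :
  (forall i j, `|M i j| <= c i) -> `|\det M| <= n`!%:R * \prod_i c i.
Proof.
move=> Mc; rewrite /determinant (le_trans (ler_norm_sum _ _ _)) //.
rewrite -card_Sn mulr_natl -sumr_const; apply: ler_sum => s _.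
rewrite normrM normr_sign mul1r normr_prod.
by apply: ler_prod => i _; rewrite normr_ge0 Mc.
Qed.

(** * Lower bound for the form L at integral Plucker matrices *)

Section LowerBound.
Variables (R : realType) (t : R).
Hypothesis t5 : t ^+ 5 = t ^+ 2 + 1.

Definition quintic_form (P : 'M[R]_5) : R :=
  \sum_k \sum_l P k l * (t ^+ k * t ^+ l.*2).

(** Since (1, t, .., t^4) is a left eigenvector with first entry 1, a unimodular row operation turns
    row 0 of M into L times this vector, and L factors out. *)
Lemma det_plucker_mx_powers (P : 'M[R]_5) :
  \det (plucker_mx P) = quintic_form P *
    \det (\matrix_(i, j) (if i == 0 then t ^+ j else plucker_mx P i j)).
Proof.
set M := plucker_mx P; set D := \matrix_(i, j) _.
pose E : 'M[R]_5 := \matrix_(i, j) (if i == 0 then t ^+ j else (i == j)%:R).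
have EM :
    E *m M = \matrix_(i, j) (if i == 0 then quintic_form P * t ^+ j else M i j).
  apply/matrixP => i j; rewrite [LHS]mxE [RHS]mxE; case: (i =P 0) => [->|/eqP i0].
    have /matrixP/(_ 0 j) := mulmx_plucker_powers P t5.
    rewrite !mxE => <-; apply: eq_bigr => k _; by rewrite !mxE eqxx.
  rewrite (bigD1 i) //= big1 => [|k ki]; rewrite !mxE (negPf i0).
    by rewrite eqxx mul1r addr0.
  by rewrite eq_sym (negPf ki) mul0r.
have detE : \det E = 1.
  rewrite -det_tr det_trig.
    rewrite big1 // => i _; rewrite !mxE eqxx.
    by case: eqP => // ->.
  apply/is_trig_mxP => i j ij; rewrite !mxE; case: eqP ij => [->//|_].
  by case: eqP => [->|//]; rewrite ltnn.
rewrite -[LHS]mul1r -detE -det_mulmx EM.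
(* Multilinearity with second coefficient 0 amounts to homogeneity in row 0. *)
rewrite (determinant_multilinear (i0 := 0) (B := D) (C := D)
  (b := quintic_form P) (c := 0)).
- by rewrite mul0r addr0.
- by apply/rowP => j; rewrite !mxE eqxx mul0r addr0.
- by apply/matrixP => i j; rewrite !mxE eq_sym (negPf (neq_lift _ _)).
- by apply/matrixP => i j; rewrite !mxE eq_sym (negPf (neq_lift _ _)).
Qed.

(** A nonzero integral determinant has absolute value at least 1. Once L is factored out, row 0 is
    bounded and only four rows are of size H, whence the exponent 4. *)
Lemma quintic_form_ge : exists2 K : R, 0 < K &
  forall (P : 'M[int]_5) (H : R), 0 <= H ->
  (forall i, P i i = 0) -> (forall i j, P i j = - P j i) ->
  (forall i j k l, P i j * P k l = P i k * P j l - P i l * P j k) ->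
  (exists i j, odd `|P i j|%N) ->
  (forall i j, `|(P i j)%:~R| <= H) ->
  1 <= K * H ^+ 4 * `|quintic_form (map_mx intr P)|.
Proof.
pose w := \sum_(j < 5) `|t ^+ j|.
pose m i j := \sum_(k < 5) \sum_(l < 5) `|(quintic_mx R ^+ (k + l.*2)) i j|.
pose K0 := w + \sum_i \sum_j m i j.
have m0 i j : 0 <= m i j by apply: sumr_ge0 => k _; apply: sumr_ge0.
have term_le (F : 'I_5 -> R) i : (forall j, 0 <= F j) -> F i <= \sum_j F j.
  by move=> F0; rewrite (bigD1 i) //= lerDl sumr_ge0.
have w0 : 0 <= w by apply: sumr_ge0.
have mK i j : m i j <= K0.
  have := term_le (fun i => \sum_j m i j) i (fun i => sumr_ge0 _ (fun j _ => m0 i j)).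
  by have := term_le (m i) j (m0 i); rewrite /K0 /=; lra.
have wK (j : 'I_5) : `|t ^+ j| <= K0.
  have wj := term_le (fun j : 'I_5 => `|t ^+ j|) j (fun=> normr_ge0 _).
  rewrite (le_trans wj) // lerDl; apply: sumr_ge0 => k _; exact: sumr_ge0.
have K00 : 0 <= K0 by apply: le_trans (wK 0).
(* There are 5! terms in the Leibniz formula and a factor [K0 + 1] for each row; the added 1 makes
   the constant positive. *)
exists (5`!%:R * (K0 + 1) ^+ 5) => [|P H H0 Pii Pa Pp Podd PH].
  by rewrite mulr_gt0 ?exprn_gt0 ?ltr0n ?fact_gt0 //; lra.
have := odd_det_plucker_mx Pii Pa Pp Podd.
set d := \det _ => d0.
have : 1 <= `|d%:~R : R| by rewrite -intr_norm ler1z -gtz0_ge1 normr_gt0.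
rewrite /d -det_map_mx map_plucker_mx det_plucker_mx_powers normrM.
move=> /le_trans; apply; rewrite mulrC ler_wpM2r //.
set D := \matrix_(i, j) _.
apply: le_trans (norm_det_le (c := fun i => if i == 0 then K0 + 1 else (K0 + 1) * H) _) _.
  move=> i j; rewrite mxE; case: eqP => _; first by have := wK j; lra.
  have : `|plucker_mx (map_mx intr P) i j| <= m i j * H.
    rewrite /plucker_mx summxE mulr_suml (le_trans (ler_norm_sum _ _ _)) //.
    apply: ler_sum => k _; rewrite summxE mulr_suml (le_trans (ler_norm_sum _ _ _)) //.
    by apply: ler_sum => l _; rewrite !mxE normrM mulrC ler_wpM2l.
  by move/le_trans; apply; rewrite ler_wpM2r // (le_trans (mK i j)) // lerDl.
rewrite -mulrA ler_wpM2l // !big_ord_recl big_ord0 /= le_eqVlt; apply/orP; left.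
by apply/eqP; ring.
Qed.

End LowerBound.

(** * Angles and linear forms *)

Section Geometry.
Variables (R : realType) (n : nat).
Implicit Types (a b X Y : 'rV[R]_n).

Lemma enorm_sqr X : enorm X ^+ 2 = \sum_i X 0 i ^+ 2.
Proof. by rewrite sqr_sqrtr // sumr_ge0 // => i _; exact: sqr_ge0. Qed.

Lemma enorm_ge0 X : 0 <= enorm X. Proof. exact: sqrtr_ge0. Qed.

Lemma enorm_gt0 X : X != 0 -> 0 < enorm X.
Proof.
move=> X0; rewrite lt_neqAle enorm_ge0 andbT eq_sym.
apply: contra X0; rewrite -sqrf_eq0 enorm_sqr psumr_eq0; last by move=> *; exact: sqr_ge0.
move=> /allP X0; apply/eqP/rowP => i; rewrite mxE.
by apply/eqP; rewrite -sqrf_eq0; apply: X0; rewrite mem_index_enum.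
Qed.

Lemma norm_coord_le_enorm X i : `|X 0 i| <= enorm X.
Proof.
rewrite -(ler_pXn2r (n := 2)) ?nnegrE ?normr_ge0 ?enorm_ge0 //.
rewrite enorm_sqr real_normK ?num_real // (bigD1 i) //= lerDl sumr_ge0 // => j _.
exact: sqr_ge0.
Qed.

Lemma norm_minor_le_wedge X Y i j :
  `|X 0 i * Y 0 j - X 0 j * Y 0 i| <= wedge_norm X Y.
Proof.
wlog ij : i j / (i < j)%N => [H|].
  case: (ltngtP i j) => [|ji|/val_inj->]; first exact: H.
    by rewrite distrC; exact: H.
  by rewrite subrr normr0; exact: sqrtr_ge0.
have S0 (k : 'I_n) : 0 <= \sum_(l < n | (k < l)%N) (X 0 k * Y 0 l - X 0 l * Y 0 k) ^+ 2.
  by apply: sumr_ge0 => l _; exact: sqr_ge0.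
rewrite -(ler_pXn2r (n := 2)) ?nnegrE ?normr_ge0 ?sqrtr_ge0 //.
rewrite sqr_sqrtr ?sumr_ge0 // real_normK ?num_real // (bigD1 i) //= (bigD1 j) //=.
by rewrite -addrA lerDl addr_ge0 ?sumr_ge0 // => l _; exact: sqr_ge0.
Qed.

Lemma sum_norm_pair_le (a b : 'rV[R]_n) (c : 'I_n -> 'I_n -> R) e f :
  (forall j, `|b 0 j| <= e) -> (forall i j, `|c i j| <= f) ->
  `|\sum_i \sum_j a 0 i * b 0 j * c i j| <= (n%:R * \sum_i `|a 0 i|) * (e * f).
Proof.
move=> be cf; rewrite (le_trans (ler_norm_sum _ _ _)) //.
rewrite -mulrA mulrCA mulr_suml; apply: ler_sum => i _.
rewrite (le_trans (ler_norm_sum _ _ _)) // -[n in n%:R]card_ord mulr_natl -sumr_const mulr_sumr.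
apply: ler_sum => j _; rewrite !normrM -mulrA ler_wpM2l //.
by rewrite ler_pM.
Qed.

(** When a.X = 0, contracting X /\ Y with a and X leaves (a.Y) times the square of |X|, up to sign.
    So a.Y is controlled by the minors of X and Y. *)
Lemma norm_dot_le_sin_angle a X Y : X != 0 -> Y != 0 ->
  \sum_i a 0 i * X 0 i = 0 ->
  `|\sum_i a 0 i * Y 0 i| <= (n%:R * \sum_i `|a 0 i|) * (sin_angle X Y * enorm Y).
Proof.
move=> /enorm_gt0 X0 /enorm_gt0 Y0 aX.
have := sum_norm_pair_le a (norm_coord_le_enorm X) (norm_minor_le_wedge X Y).
have -> : \sum_i \sum_j a 0 i * X 0 j * (X 0 i * Y 0 j - X 0 j * Y 0 i)
    = - ((\sum_i a 0 i * Y 0 i) * enorm X ^+ 2).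
  rewrite enorm_sqr mulr_suml -sumrN.
  transitivity ((\sum_i a 0 i * X 0 i) * (\sum_j X 0 j * Y 0 j) 
     + \sum_i - (a 0 i * Y 0 i * \sum_j X 0 j ^+ 2)); last by rewrite aX mul0r add0r.
  rewrite mulr_suml -big_split; apply: eq_bigr => i _ /=.
  by rewrite !mulr_sumr -sumrB; apply: eq_bigr => j _; ring.
rewrite normrN normrM normrX (ger0_norm (ltW X0)) /sin_angle => h.
rewrite -(ler_pM2r (exprn_gt0 2 X0)) (le_trans h) // le_eqVlt; apply/orP; left.
by apply/eqP; field; rewrite !gt_eqF.
Qed.

(** The hypothesis on Y and P says Y /\ P = 0. Multiplied by a_i b_j Y_k and summed, it expresses L
    |Y|^2 through a.Y and b.Y, both small by the previous lemma; the factor 2 counts these two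
    terms. *)
Lemma plucker_form_le_sin_angle a b X Y (P : 'M[R]_n) (H : R) :
  X != 0 -> Y != 0 -> (forall i j, `|P i j| <= H) ->
  (forall i j k, Y 0 k * P i j + Y 0 i * P j k + Y 0 j * P k i = 0) ->
  \sum_i a 0 i * X 0 i = 0 -> \sum_i b 0 i * X 0 i = 0 ->
  `|\sum_i \sum_j P i j * (a 0 i * b 0 j)|
   <= 2 * (n%:R * \sum_i `|a 0 i|) * (n%:R * \sum_i `|b 0 i|) * (H * sin_angle X Y).
Proof.
move=> X0 Y0 PH YP /(norm_dot_le_sin_angle X0 Y0) aY /(norm_dot_le_sin_angle X0 Y0) bY.
have Yp := enorm_gt0 Y0.
set L := \sum_i _.
have : L * enorm Y ^+ 2 = - ((\sum_i a 0 i * Y 0 i) * (\sum_j \sum_k b 0 j * Y 0 k * P j k)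
   + (\sum_j b 0 j * Y 0 j) * (\sum_i \sum_k a 0 i * Y 0 k * P k i)).
  rewrite enorm_sqr /L.
  have -> : (\sum_i a 0 i * Y 0 i) * (\sum_j \sum_k b 0 j * Y 0 k * P j k)
      = \sum_i \sum_j \sum_k a 0 i * Y 0 i * (b 0 j * Y 0 k * P j k).
    rewrite mulr_suml; apply: eq_bigr => i _; rewrite mulr_sumr.
    by apply: eq_bigr => j _; rewrite mulr_sumr.
  have -> : (\sum_j b 0 j * Y 0 j) * (\sum_i \sum_k a 0 i * Y 0 k * P k i)
      = \sum_i \sum_j \sum_k b 0 j * Y 0 j * (a 0 i * Y 0 k * P k i).
    rewrite mulr_sumr; apply: eq_bigr => i _; rewrite mulr_suml.
    by apply: eq_bigr => j _; rewrite mulr_sumr.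
  rewrite -big_split -sumrN mulr_suml; apply: eq_bigr => i _ /=.
  rewrite mulr_suml -big_split -sumrN; apply: eq_bigr => j _ /=.
  rewrite mulr_sumr -big_split -sumrN; apply: eq_bigr => k _ /=.
  by rewrite -[LHS]subr0 -(mulr0 (a 0 i * b 0 j * Y 0 k)) -(YP i j k); ring.
move/(congr1 Num.norm); rewrite normrM (ger0_norm (exprn_ge0 2 (ltW Yp))) normrN => LE.
rewrite -(ler_pM2r (exprn_gt0 2 Yp)) {}LE (le_trans (ler_normD _ _)) //.
have hb := sum_norm_pair_le b (norm_coord_le_enorm Y) PH.
have ha := sum_norm_pair_le a (norm_coord_le_enorm Y) (fun i k => PH k i).
rewrite !normrM.
have h1 := ler_pM (normr_ge0 _) (normr_ge0 _) aY hb.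
have h2 := ler_pM (normr_ge0 _) (normr_ge0 _) bY ha.
by apply: le_trans (lerD h1 h2) _; rewrite le_eqVlt; apply/orP; left; apply/eqP; ring.
Qed.

End Geometry.

(** * Plucker coordinates of rational planes *)

Lemma rat_primitive_scaling (I : finType) (p : pred I) (q : I -> rat) :
  (exists2 s, p s & q s != 0) ->
  exists (c : rat) (z : I -> int), [/\ c != 0,
    forall s, p s -> (z s)%:~R = c * q s
    & \big[gcdn/0%N]_(s | p s) `|z s|%N = 1%N].
Proof.
case=> s0 ps0 qs0.
pose d := \prod_s denq (q s).
have d0 : d != 0 by apply/prodf_neq0 => s _; exact: denq_neq0.
pose y s : int := numq (q s) * \prod_(t | t != s) denq (q t).
have yE s : (y s)%:~R = d%:~R * q s :> rat.
  rewrite /y /d [in RHS](bigD1 s) //= !intrM numqE; ring.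
pose g := \big[gcdn/0%N]_(s | p s) `|y s|%N.
have gy s : p s -> (g %| `|y s|)%N by move=> ps; exact: biggcdn_inf ps (dvdnn _).
have g0 : (0 < g)%N.
  rewrite lt0n; apply: contraNneq qs0 => g0; have := gy _ ps0.
  rewrite g0 dvd0n absz_eq0 => /eqP/(congr1 (fun z : int => z%:~R : rat)).
  by rewrite yE => /eqP; rewrite mulf_eq0 intr_eq0 (negPf d0).
have gyz s : p s -> y s = (y s %/ g)%Z * g.
  by move=> ps; rewrite divzK // dvdzE; exact: gy.
exists (d%:~R / g%:R), (fun s => (y s %/ g)%Z); split.
- by rewrite mulf_neq0 ?invr_eq0 ?intr_eq0 // pnatr_eq0 -lt0n.
- move=> s ps; rewrite mulrAC -yE [in RHS]gyz // intrM -pmulrn mulfK //.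
  by rewrite pnatr_eq0 -lt0n.
- apply/eqP; rewrite -(eqn_pmul2l g0) muln1; apply/eqP.
  rewrite big_distrr {2}/g.
  by apply: eq_bigr => s ps; rewrite [in RHS]gyz // abszM mulnC.
Qed.

Lemma det_mx22 (T : comPzRingType) (M : 'M[T]_2) :
  \det M = M 0 0 * M 1 1 - M 0 1 * M 1 0.
Proof.
rewrite (expand_det_row _ 0) !big_ord_recl big_ord0 /cofactor !det_mx11 !mxE /=.
rewrite expr0 expr1 mul1r addr0 mulN1r mulrN.
by congr (_ * M _ _ - M _ _ * M _ _); apply/val_inj.
Qed.

Section Plucker.
Variables (R : realType) (n : nat).
Implicit Types (B : {vspace 'rV[R]_n}) (P : 'M[int]_n).

(** Plucker coordinates of a plane extended to all pairs by antisymmetry. The factor [c] is there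
    because primitive coordinates are only proportional to the minors of a basis. *)
Definition is_plucker_matrix B P : Prop := exists u v c,
  [/\ basis_of B [:: u; v], c != 0
    & forall i j, (P i j)%:~R = c * (u 0 i * v 0 j - u 0 j * v 0 i)].

Definition pair_map (i j : 'I_n) : {ffun 'I_2 -> 'I_n} :=
  [ffun k => if k == 0 then i else j].

Lemma increasing_map2 (s : {ffun 'I_2 -> 'I_n}) :
  increasing_map s = (s 0%R < s 1%R)%N.
Proof.
apply/forallP/idP => [/(_ 0)/forallP/(_ 1)//|s01 i]; apply/forallP => k.
apply/implyP; case: i k => [[|[|//]] i2] [[|[|//]] k2] // _.
by rewrite (_ : Ordinal i2 = 0) 1?(_ : Ordinal k2 = 1) //; apply/val_inj.
Qed.

Lemma pair_mapE (s : {ffun 'I_2 -> 'I_n}) : s = pair_map (s 0) (s 1).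
Proof.
apply/ffunP => k; rewrite ffunE; case: eqP => [->//|/eqP k0].
by congr (s _); apply/val_inj; case: k k0 => [[|[|]]].
Qed.

Lemma increasing_pair_map i j : increasing_map (pair_map i j) = (i < j)%N.
Proof. by rewrite increasing_map2 !ffunE. Qed.

Lemma det_colsub_pair (T : comPzRingType) (X : 2.-tuple 'rV[T]_n) s :
  \det (colsub s (\matrix_(i < 2) tnth X i)) =
   (tnth X 0) 0 (s 0) * (tnth X 1) 0 (s 1) - (tnth X 0) 0 (s 1) * (tnth X 1) 0 (s 0).
Proof. by rewrite det_mx22 !mxE. Qed.

Lemma tuple2E (T : Type) (X : 2.-tuple T) : X = [:: tnth X 0; tnth X 1] :> seq T.
Proof. by case: X => -[|x [|y []]]. Qed.

(** The length [e] is a variable so that the lemma applies to [\dim B], which equals 2 only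
    propositionally. An odd entry exists because otherwise 2 would divide the gcd. *)
Lemma plucker_matrix_of_vector e (Xi : {ffun 'I_e -> 'I_n} -> int) B :
  e = 2%N -> is_plucker_vector B (fun s => (Xi s)%:~R : R) ->
  \big[gcdn/0%N]_(s | increasing_map s) `|Xi s|%N = 1%N ->
  exists P, [/\ is_plucker_matrix B P, exists i j, odd `|P i j|%N
    & forall i j, `|(P i j)%:~R| <=
       Num.sqrt (\sum_(s : {ffun 'I_e -> 'I_n} | increasing_map s)
                      (Xi s)%:~R ^+ 2) :> R].
Proof.
move=> e2; subst e => -[X [c [bX c0 XiE]]] gcd1.
exists (\matrix_(i, j) if (i < j)%N then Xi (pair_map i j)
  else if (j < i)%N then - Xi (pair_map j i) else 0); split.
- exists (tnth X 0), (tnth X 1), c; split=> //.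
    by rewrite -tuple2E.
  move=> i j; rewrite mxE; case: ltngtP => [ij|ji|/val_inj->].
  + by rewrite XiE ?increasing_pair_map // det_colsub_pair !ffunE.
  + by rewrite rmorphN /= XiE ?increasing_pair_map // det_colsub_pair !ffunE /=; ring.
  + by ring.
- apply: contrapT => /forallNP even_P; suff: (2 %| 1)%N by [].
  rewrite -[X in (_ %| X)%N]gcd1; apply/dvdn_biggcdP => s; rewrite increasing_map2 => s01.
  have /forallNP/(_ (s 1)) := even_P (s 0).
  by rewrite mxE s01 -pair_mapE dvdn2 => /negP.
have XiH s : increasing_map s -> `|(Xi s)%:~R| <=
       Num.sqrt (\sum_(s : {ffun 'I_2 -> 'I_n} | increasing_map s)
                      (Xi s)%:~R ^+ 2) :> R.
  move=> incr_s; rewrite -sqrtr_sqr ler_wsqrtr // (bigD1 s) //= lerDl.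
  by apply: sumr_ge0 => *; exact: sqr_ge0.
move=> i j; rewrite mxE; case: ltngtP => [ij|ji|_].
- by apply: XiH; rewrite increasing_pair_map.
- by rewrite rmorphN normrN; apply: XiH; rewrite increasing_pair_map.
- by rewrite normr0 sqrtr_ge0.
Qed.

Lemma mem_basis2 B u v Y : basis_of B [:: u; v] ->
  Y \in B -> exists x y, Y = x *: u + y *: v.
Proof.
move=> /span_basis <-; rewrite span_cons span_seq1.
by case/memv_addP => _ /vlineP[x ->] [_ /vlineP[y ->] ->]; exists x, y.
Qed.

Section PluckerMatrix.
Variables (B : {vspace 'rV[R]_n}) (P : 'M[int]_n).
Hypothesis BP : is_plucker_matrix B P.

Lemma plucker_matrix_alt i : P i i = 0.
Proof.
case: BP => u [v [c [_ _ PE]]]; apply/eqP; rewrite -(intr_eq0 R) PE.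
by apply/eqP; ring.
Qed.

Lemma plucker_matrix_antisym i j : P i j = - P j i.
Proof.
case: BP => u [v [c [_ _ PE]]]; apply/eqP; rewrite -(eqr_int R) rmorphN /= !PE.
by apply/eqP; ring.
Qed.

Lemma plucker_matrix_relation i j k l :
  P i j * P k l = P i k * P j l - P i l * P j k.
Proof.
case: BP => u [v [c [_ _ PE]]]; apply/eqP.
by rewrite -(eqr_int R) rmorphB !rmorphM /= !PE; apply/eqP; ring.
Qed.

(** The left side is [c] times a 3 by 3 minor of the dependent vectors Y, u, v. *)
Lemma plucker_matrix_mem Y i j k : Y \in B ->
  Y 0 k * (P i j)%:~R + Y 0 i * (P j k)%:~R + Y 0 j * (P k i)%:~R = 0.
Proof.
case: BP => u [v [c [bB _ PE]]] /(mem_basis2 bB)[x [y ->]].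
by rewrite !PE !mxE; ring.
Qed.

Lemma span_plucker_matrix : P != 0 ->
  B = <<[seq row i (map_mx (intr : int -> R) P) | i <- enum 'I_n]>>%VS.
Proof.
move=> /matrix0Pn[i [j Pij]]; apply/eqP; rewrite eqEsubv; apply/andP; split.
  apply/subvP => Y YB.
  (* This is the relation of [plucker_matrix_mem] solved for the coordinate Y_k. *)
  have -> : Y = (P i j)%:~R^-1 *: (Y 0 j *: row i (map_mx intr P)
              - Y 0 i *: row j (map_mx intr P)).
    apply/rowP => k; rewrite !mxE.
    have := plucker_matrix_mem i j k YB.
    rewrite (plucker_matrix_antisym k i) rmorphN /= => E.
    have Pij0 : (P i j)%:~R != 0 :> R by rewrite intr_eq0.
    apply: (mulfI Pij0); rewrite mulrA mulfV // mul1r.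
    by apply/eqP; rewrite -subr_eq0; apply/eqP; rewrite -[RHS]E; ring.
  rewrite memvZ // memvB // memvZ // memv_span //.
    by apply/map_f; rewrite mem_enum.
  by apply/map_f; rewrite mem_enum.
apply/span_subvP => _ /mapP[k _ ->].
case: BP => u [v [c [bB _ PE]]].
have -> : row k (map_mx intr P) = (c * u 0 k) *: v - (c * v 0 k) *: u.
  by apply/rowP => l; rewrite !mxE PE; ring.
by rewrite memvB // memvZ // -(span_basis bB) memv_span // !inE eqxx ?orbT.
Qed.

End PluckerMatrix.

Lemma free2_minor (u v : 'rV[R]_n) : free [:: u; v] ->
  exists i j : 'I_n, u 0 i * v 0 j - u 0 j * v 0 i != 0.
Proof.
rewrite free_cons span_seq1 seq1_free => /andP[/negP uv v0].
have /existsNP[j vj] : ~ forall j, v 0 j = 0.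
  by move=> vj; case/eqP: v0; apply/rowP => j; rewrite mxE.
apply: contrapT => /forallNP minor0; apply: uv; apply/vlineP.
exists (u 0 j / v 0 j); apply/rowP => i; rewrite mxE.
have /forallNP/(_ j)/negP := minor0 i.
rewrite negbK subr_eq0 => /eqP E.
have /eqP vj0 := vj.
by apply: (mulIf vj0); rewrite E; field.
Qed.

(** The minors of a rational basis are rational and not all zero, so they can be scaled to coprime
    integers. This shows that [height] is not the default value of [xget]. *)
Lemma exists_primitive_plucker_vector B : \dim B = 2%N -> is_rational B ->
  exists Xi, @is_primitive_plucker_vector R n B Xi.
Proof.
rewrite /is_rational /is_primitive_plucker_vector.
move: (\dim B) => e e2; subst e => -[X bX].
pose XR := [tuple of map (map_mx (ratr : rat -> R)) X].
pose q (s : {ffun 'I_2 -> 'I_n}) : rat := \det (colsub s (\matrix_(i < 2) tnth X i)).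
have qE s : ratr (q s) = \det (colsub s (\matrix_(i < 2) tnth XR i)) :> R.
  by rewrite /q !det_colsub_pair !tnth_map !mxE rmorphB !rmorphM.
have q0 s : (q s == 0) =
    (\det (colsub s (\matrix_(i < 2) tnth XR i)) == 0 :> R).
  by rewrite -qE fmorph_eq0.
have [|c [z [c0 zE gcd1]]] := @rat_primitive_scaling _ (@increasing_map n 2) q.
  have : free [:: tnth XR 0; tnth XR 1].
    by have := basis_free bX; rewrite -[map _ _]/(tval XR) tuple2E.
  case/free2_minor => i [j]; case: (ltngtP i j) => [ij|ji|/val_inj->] m0.
  - exists (pair_map i j); rewrite ?increasing_pair_map //.
    by rewrite q0 det_colsub_pair !ffunE.
  - exists (pair_map j i); rewrite ?increasing_pair_map //.
    by rewrite q0 det_colsub_pair !ffunE -oppr_eq0 opprB.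
  - by rewrite subrr eqxx in m0.
exists [ffun s => z s]; split.
  exists XR, (ratr c); split=> //; first by rewrite fmorph_eq0.
  by move=> s incr_s; rewrite ffunE -qE -rmorphM -zE // rmorph_int.
by under eq_bigr do rewrite ffunE.
Qed.

End Plucker.

(** * The subspace attached to a root of X^5 - X^2 - 1 *)

Lemma height_plucker_matrix (R : realType) n (B : {vspace 'rV[R]_n}) :
  rational_subspaces 2 B ->
  exists P, [/\ is_plucker_matrix B P, exists i j, odd `|P i j|%N
    & forall i j, `|(P i j)%:~R| <= height B].
Proof.
case=> ratB dimB.
have [Xi0 primXi0] := exists_primitive_plucker_vector dimB ratB.
have := @xgetPex _ (0 : R) [set h | exists2 Xi, is_primitive_plucker_vector Xi
    & h = Num.sqrt (\sum_(s : {ffun 'I_(\dim B) -> 'I_n} | increasing_map s)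
                      (Xi s)%:~R ^+ 2)]%classic.
case; first by eexists; exists Xi0.
move=> Xi [plXi gcd1] hE; rewrite /height hE.
exact: plucker_matrix_of_vector dimB plXi gcd1.
Qed.

Lemma orthogonal_hyperplaneP (R : realType) n (a X : 'rV[R]_n) :
  reflect (\sum_i a 0 i * X 0 i = 0) (X \in orthogonal_hyperplane a).
Proof.
rewrite memv_ker lfunE /=; apply: (iffP eqP) => [/rowP/(_ 0)|E].
  by rewrite !mxE => E; rewrite -[RHS]E; apply: eq_bigr => i _; rewrite !mxE mulrC.
apply/rowP => k; rewrite ord1 !mxE -[RHS]E.
by apply: eq_bigr => i _; rewrite !mxE mulrC.
Qed.

Lemma dim_cap_orthogonal_hyperplane (R : realType) n (U : {vspace 'rV[R]_n}) a :
  (\dim U <= (\dim (U :&: orthogonal_hyperplane a)).+1)%N.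
Proof.
rewrite -(limg_ker_dim (linfun (mulmxr a^T : 'rV[R]_n -> 'rV[R]_1)) U) -[leqRHS]addn1.
by rewrite leq_add2l (leq_trans (dimvS (subvf _))) // dimvf dim_matrix.
Qed.

Lemma finite_bounded_int_mx (R : realType) m n (K : R) :
  finite_set [set P : 'M[int]_(m, n) | forall i j, `|(P i j)%:~R| <= K]%classic.
Proof.
(* The entries satisfy |P i j| < N; shifted by N they fit in ['I_(N.*2.+1)]. *)
pose N := Num.bound K.
pose F (M : 'M['I_(N.*2.+1)]_(m, n)) : 'M[int]_(m, n) :=
  map_mx (fun k : 'I_(N.*2.+1) => (k : nat)%:Z - N%:Z) M.
apply: (sub_finite_set (B := (F @` [set: _])%classic)); last first.
  by apply: finite_image; exact: finite_finset.
move=> P /= PK; exists (map_mx (fun z : int => inord (absz (z + N%:Z))) P) => //.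
apply/matrixP => i j; rewrite !mxE.
have : `|P i j| < N%:Z.
  rewrite -(ltr_int R) intr_norm (le_lt_trans (PK i j)) //.
  by apply: archi_boundP; apply: le_trans (PK i j); exact: normr_ge0.
by move=> PN; rewrite inordK; lia.
Qed.

Section QuinticSubspace.
Variables (R : realType) (t : R).
Hypothesis t5 : t ^+ 5 = t ^+ 2 + 1.

Definition quintic_subspace : {vspace 'rV[R]_5} :=
  (orthogonal_hyperplane (\row_i t ^+ i)
   :&: orthogonal_hyperplane (\row_i t ^+ i.*2))%VS.

Let A := quintic_subspace.

(** Combine the lower bound 1 <= K H^4 |L| with the upper bound |L| <= C H sin(X, Y). The height is
    at least 1 because some Plucker coordinate is odd. *)
Lemma sin_angle_quintic_subspace_ge : exists2 K : R, 0 < K &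
  forall B X Y, rational_subspaces 2 B ->
    X \in A -> X != 0 -> Y \in B -> Y != 0 ->
    1 <= height B /\ 1 <= K * height B ^+ 5 * sin_angle X Y.
Proof.
have [K K0 KP] := quintic_form_ge t5.
pose norm1 (a : 'rV[R]_5) := 5%:R * \sum_i `|a 0 i|.
have norm1_ge0 a : 0 <= norm1 a by rewrite mulr_ge0 ?sumr_ge0.
pose C := 2 * norm1 (\row_i t ^+ i) * norm1 (\row_i t ^+ i.*2).
have C0 : 0 <= C by rewrite /C mulr_ge0 // mulr_ge0.
exists (K * (C + 1)) => [|B X Y ratB]; first by rewrite mulr_gt0 //; lra.
rewrite memv_cap => /andP[/orthogonal_hyperplaneP aX /orthogonal_hyperplaneP bX].
move=> X0 YB Y0.
have [P [BP Podd PH]] := height_plucker_matrix ratB.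
have H1 : 1 <= height B.
  case: Podd => i [j oddP]; apply: le_trans (PH i j).
  by rewrite -intr_norm ler1z; lia.
have H0 : 0 <= height B by apply: le_trans H1.
split=> //.
have := KP P _ H0 (plucker_matrix_alt BP) (plucker_matrix_antisym BP)
  (plucker_matrix_relation BP) Podd PH.
move=> h; apply: le_trans h _.
have := @plucker_form_le_sin_angle R 5 _ _ X Y (map_mx intr P) (height B) X0 Y0 _ _ aX bX.
have s0 : 0 <= sin_angle X Y.
  by rewrite divr_ge0 ?mulr_ge0 ?enorm_ge0 ?sqrtr_ge0.
rewrite (_ : \sum_i _ = quintic_form t (map_mx intr P)); last first.
  by apply: eq_bigr => i _; apply: eq_bigr => j _; rewrite !mxE.
rewrite -/(norm1 _) -/(norm1 _) -/C => le_form.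
apply: le_trans (_ : K * height B ^+ 4 * (C * (height B * sin_angle X Y)) <= _).
  rewrite ler_wpM2l ?mulr_ge0 ?exprn_ge0 ?(ltW K0) // le_form // => [i j|i j k].
    by rewrite mxE.
  rewrite !mxE. by have := plucker_matrix_mem BP i j k YB.
rewrite -subr_ge0.
rewrite (_ : _ - _ = K * height B ^+ 5 * sin_angle X Y); last by ring.
by rewrite mulr_ge0 // mulr_ge0 ?exprn_ge0 // ltW.
Qed.

Lemma sin_anglexx n (X : 'rV[R]_n) : sin_angle X X = 0.
Proof.
rewrite /sin_angle /wedge_norm big1 ?sqrtr0 ?mul0r // => i _.
by rewrite big1 // => j _; rewrite mulrC subrr expr0n.
Qed.

(** A nonzero vector common to A and a rational plane would make an angle of sine 0 with itself,
    against the lower bound. *)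
Lemma quintic_subspace_irrational : irrational_subspaces 3 2 1 A.
Proof.
split; last first.
  move=> B ratB; rewrite ltnS leqn0 dimv_eq0 -vpick0; apply: contraT => X0.
  have := memv_pick (A :&: B); rewrite memv_cap => /andP[XA XB].
  have [K _ /(_ _ _ _ ratB XA X0 XB X0)[_]] := sin_angle_quintic_subspace_ge.
  by rewrite sin_anglexx mulr0 ler10.
apply/eqP; rewrite eqn_leq; apply/andP; split; last first.
  have := dim_cap_orthogonal_hyperplane
    (orthogonal_hyperplane (\row_(i < 5) t ^+ i)) (\row_i t ^+ i.*2).
  have := dim_cap_orthogonal_hyperplane fullv (\row_(i < 5) t ^+ i).
  rewrite dimvf dim_matrix capfv -/A -[(_ * _)%R]/5%N ltnS.
  by move=> h1 h2; have := leq_trans h1 h2.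
pose e i : 'rV[R]_5 := delta_mx 0 i.
(* To get dim A <= 3, A is shown to meet this coordinate plane trivially: there the forms are x + t
   y and x + t^2 y, independent since t is neither 0 nor 1. *)
pose B := (<[e 0%R]> + <[e 1%R]>)%VS.
have e_neq0 i : e i != 0.
  by apply/eqP => /rowP/(_ i); rewrite !mxE !eqxx => /eqP; rewrite oner_eq0.
have dimB : \dim B = 2%N.
  rewrite /B dimv_disjoint_sum ?dim_vline ?e_neq0 //.
  apply/eqP; rewrite -subv0; apply/subvP => X; rewrite memv_cap.
  case/andP => /vlineP[x ->] /vlineP[y] /rowP/(_ 0); rewrite !mxE !eqxx /= mulr0 mulr1 => ->.
  by rewrite scale0r mem0v.
have AB : \dim (A :&: B) = 0%N.
  apply/eqP; rewrite dimv_eq0 -subv0; apply/subvP => X; rewrite !memv_cap.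
  case/andP => /andP[/orthogonal_hyperplaneP aX /orthogonal_hyperplaneP bX].
  case/memv_addP => _ /vlineP[x ->] [_ /vlineP[y ->] E].
  move: aX bX; rewrite E !big_ord_recl !big_ord0 !mxE /=.
  rewrite !(mulr0, mulr1, addr0, add0r, mul1r, expr0, expr1) => xy xy2.
  have /eqP : y * (t * (t - 1)) = 0 by rewrite -[RHS](subrr 0) -{1}xy2 -xy; ring.
  rewrite mulf_eq0 => /orP[/eqP y0|]; last first.
    by rewrite mulf_eq0 subr_eq0 => /orP[] /eqP t01; move: t5; rewrite t01; lra.
  by move: xy; rewrite y0 mulr0 addr0 => ->; rewrite !scale0r addr0 mem0v.
have := dimv_sum_cap A B; rewrite AB dimB addn0 => E.
have := dimvS (subvf (A + B)); rewrite E dimvf dim_matrix.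
by rewrite -[(_ * _)%R]/(3 + 2)%N leq_add2r.
Qed.

(** If beta > 6, then 1/(K H^5) <= psi_1 <= H^(-6), so H <= K. The Plucker matrices of such planes
    have entries bounded by K, and each determines its plane, so these planes are finitely many. *)
Lemma exponent_quintic_subspace : (exponent A 2 1 <= 6%:E)%E.
Proof.
have [K K0 KP] := sin_angle_quintic_subspace_ge.
rewrite /exponent ge_max lee_fin ler0n /=.
apply: ge_ereal_sup => _ [beta [beta0 inf_B] <-].
rewrite lee_fin leNgt; apply/negP => beta6; apply: inf_B.
pose F (P : 'M[int]_5) : {vspace 'rV[R]_5} :=
  <<[seq row i (map_mx (intr : int -> R) P) | i <- enum 'I_5]>>%VS.
have finF := finite_image F (@finite_bounded_int_mx R 5 5 K).
refine (sub_finite_set _ finF).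
move=> B [ratB prox] /=.
have A0 : vpick A != 0.
  by rewrite vpick0 -dimv_eq0 quintic_subspace_irrational.1.
have B0 : vpick B != 0 by rewrite vpick0 -dimv_eq0 ratB.2.
have [H1 _] := KP _ _ _ ratB (memv_pick A) A0 (memv_pick B) B0.
set H := height B in H1 prox.
have Hp : 0 < H by apply: lt_le_trans H1.
have KH0 : 0 < K * H ^+ 5 by rewrite mulr_gt0 ?exprn_gt0.
(* For j = 1 the proximity is the infimum over A and B themselves, and [lb_le_inf] asks that the set
   of sines be nonempty. *)
have prox_ge : (K * H ^+ 5)^-1 <= proximity 1 A B.
  apply: lb_le_inf.
    by exists (sin_angle (vpick A) (vpick B)), (vpick A), (vpick B); split; rewrite ?memv_pick.
  move=> _ [X [Y [XA X0 YB Y0 ->]]].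
  have [_ le1] := KP _ _ _ ratB XA X0 YB Y0.
  by rewrite -[leLHS]mul1r ler_pdivrMr // mulrC.
have powH : H `^ (- beta) <= (H ^+ 6)^-1.
  rewrite -powR_mulrn ?(ltW Hp) // -powRN; apply: ler_powR => //.
  by rewrite lerN2 ltW.
have HK : H <= K.
  have := le_trans prox_ge (le_trans prox powH).
  rewrite lef_pV2 ?posrE ?exprn_gt0 // exprS ler_pM2r // exprn_gt0 //.
have [P [BP [i [j oddP]] PH]] := height_plucker_matrix ratB.
exists P; first by move=> i' j'; apply: le_trans (PH _ _) HK.
rewrite /F -(span_plucker_matrix BP) //.
by apply/eqP => P0; rewrite P0 mxE in oddP.
Qed.

End QuinticSubspace.

Theorem theorem1p6 (R : realType) : (least_exponent R 5 3 2 1 <= 6%:E)%E.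
Proof.
(* The polynomial takes the values -1 at 1 and 27 at 2. *)
have [t _ /rootP] : exists2 t : R, 1 <= t <= 2 & root ('X^5 - 'X^2 - 1) t.
  by apply: poly_ivt; rewrite ?ler1n // !hornerE; lra.
rewrite !hornerE => t5E.
have t5 : t ^+ 5 = t ^+ 2 + 1 by lra.
apply: ge_ereal_inf; exists (exponent (quintic_subspace t) 2 1); last first.
  exact: exponent_quintic_subspace.
by exists (quintic_subspace t) => //; exact: quintic_subspace_irrational.
Qed.
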